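(* Let $G$ be a finite connected graph (loops and multiple edges allowed) and $T_0\subset G$ a spanning tree. Let $N=|E(G-T_0)|$, and let $Mesh(G,T_0)$ be the $N\times N$ mesh matrix and $Mesh^\#(G,T_0)=Y^t Y$ the reduced mesh matrix, so that $Mesh(G,T_0)=Id+Y^tY$. For $j=0,1,\dots,N$ let $ST_j(G,T_0)$ be the number of spanning trees $T$ of $G$ with $|E(T)\cap E(G-T_0)|=j$. Then $$\det((U+1)\,Id-Mesh(G,T_0))=\det(U\,Id-Mesh^\#(G,T_0))=U^N+\sum_{j=1}^N(-1)^j\,ST_j(G,T_0)\,U^{N-j}.$$ In particular, setting $U=-1$, $\det(Mesh(G,T_0))=\sum_{j=0}^N ST_j(G,T_0)$, the number of spanning trees of $G$.
   Context: Choose an orientation for every edge of $G$. List the edges of $E(G-T_0)$ as $\vec e_1,\dots,\vec e_N$ and those of $T_0$ as $\vec f_1,\dots,\vec f_M$, $M=|E(T_0)|$; $C_1(G;\mathbb R)$ is the real vector space with basis the oriented edges, with the standard inner product $\langle\cdot,\cdot\rangle$ making the edges orthonormal. For $\vec e_j$ directed from $P_j$ to $Q_j$: if $P_j=Q_j$ (a loop) put $D(\vec e_j)=0$; otherwise let $D(\vec e_j)\in C_1(T_0;\mathbb Z)$ be the 1-chain given by the unique simple path in $T_0$ from $Q_j$ to $P_j$, each of its edges taken with the orientation in which the path traverses it (so $\partial D(\vec e_j)=P_j-Q_j$). Put $Z[j]=\vec e_j+D(\vec e_j)$, an integral 1-cycle. The mesh matrix is $Mesh(G,T_0)=(\langle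 Z[i],Z[j]\rangle)_{1\le i,j\le N}$. Let $Y$ be the $M\times N$ matrix of $D$ with respect to the bases $\{\vec e_j\}$, $\{\vec f_k\}$ (entries $0,\pm1$), i.e. $Z[j]=\vec e_j+\sum_k Y_{kj}\vec f_k$; then $Mesh(G,T_0)=Id+Y^tY$ and $Mesh^\#(G,T_0):=Y^tY$. *)

(* Defs.v *)
From HB Require Import structures.
From mathcomp Require Import all_boot all_order all_algebra.
From Stdlib Require Import ClassicalEpsilon.
Set Implicit Arguments. Unset Strict Implicit. Unset Printing Implicit Defensive.
Import Order.TTheory GRing.Theory Num.Theory.

(* A graph G: finite vertex type V, finite edge type E, each edge e oriented
   from [src e] (= P) to [tgt e] (= Q).  A loop is an edge with src e = tgt e. *)
Section Graph.
Variables (V E : finType) (src tgt : E -> V).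

Definition step_src (st : E * bool) : V := if st.2 then src st.1 else tgt st.1.
Definition step_tgt (st : E * bool) : V := if st.2 then tgt st.1 else src st.1.

Fixpoint walk (x y : V) (s : seq (E * bool)) : bool :=
  match s with
  | [::] => x == y
  | st :: s' => (step_src st == x) && walk (step_tgt st) y s'
  end.

Definition walk_verts (x : V) (s : seq (E * bool)) : seq V := x :: map step_tgt s.

Definition in_edges (F : {set E}) (s : seq (E * bool)) : bool :=
  all (fun st => st.1 \in F) s.

Definition simple_path (F : {set E}) (x y : V) (s : seq (E * bool)) : bool :=
  [&& walk x y s, in_edges F s, uniq (map fst s) & uniq (walk_verts x s)].

Definition connected_in (F : {set E}) : Prop :=
  forall x y : V, exists s, walk x y s && in_edges F s.

(* the spanning subgraph (V, F) has no cycle: no nonempty closed walk without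
   repeated edges (a loop or two parallel edges form cycles) *)
Definition acyclic (F : {set E}) : Prop :=
  forall (x : V) (s : seq (E * bool)),
    walk x x s -> in_edges F s -> uniq (map fst s) -> s = [::].

Definition spanning_tree (F : {set E}) : Prop := connected_in F /\ acyclic F.

(* classical boolean reflection of a Prop, to count spanning trees *)
Definition decP (P : Prop) : bool :=
  if excluded_middle_informative P then true else false.

Definition spanning_treeb (F : {set E}) : bool := decP (spanning_tree F).

Definition ST (T0 : {set E}) (j : nat) : nat :=
  #|[set T : {set E} | spanning_treeb T & #|T :&: ~: T0| == j]|.

Definition num_spanning_trees : nat := #|[set T : {set E} | spanning_treeb T]|.

(* Coefficient of the tree edge f in D(e), where [path e] is the chosen simple
   path in T0 from Q = tgt e to P = src e; D(e) = 0 for a loop e. *)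
Definition Dcoef (path : E -> seq (E * bool)) (f e : E) : int :=
  if src e == tgt e then 0%R
  else (\sum_(st <- path e | st.1 == f) (if st.2 then 1 else -1))%R.

Definition Ymat (T0 : {set E}) (path : E -> seq (E * bool))
  : 'M[int]_(#|T0|, #|~: T0|) :=
  \matrix_(k < #|T0|, j < #|~: T0|) Dcoef path (enum_val k) (enum_val j).

Definition MeshS (T0 : {set E}) path : 'M[int]_#|~: T0| :=
  ((Ymat T0 path)^T *m Ymat T0 path)%R.

Definition Mesh (T0 : {set E}) path : 'M[int]_#|~: T0| :=
  (1%:M + MeshS T0 path)%R.

End Graph.

(* Main.v *)
(** Let C be the matrix whose rows are the fundamental cycles Z[j] on all edges,
    so that a Id + b Y^t Y = C W C^t, where W is diagonal with entries b on T0
    and a off T0. By Cauchy-Binet its determinant is the sum, over the N-sets S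
    of edges, of the weight of S times the square of the minor det C_S. Since
    every cycle is an integral combination of the rows of C, this minor is
    invertible over the integers when the complement T of S is a spanning tree
    (use the fundamental cycles of T). If it is nonzero, no cycle is supported
    on T, and the endpoints of each edge of S lie in the same component of T,
    so T is a spanning tree. The weight of S is then b^j a^(N-j) with
    j = |E(T) - E(T0)|; take (a, b) = (U, -1) and (1, 1). *)

Require Import Defs.
From HB Require Import structures.
From mathcomp Require Import all_boot all_order all_fingroup all_algebra.
From Stdlib Require Import ClassicalEpsilon.
Set Implicit Arguments.
Unset Strict Implicit.
Unset Printing Implicit Defensive.
Import Order.TTheory GRing.Theory Num.Theory.
Local Open Scope ring_scope.

Lemma decPP (P : Prop) : reflect P (Defs.decP P).
Proof. by rewrite /Defs.decP; case: excluded_middle_informative => ?; constructor. Qed.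

(** * Cauchy-Binet for weighted Gram matrices *)

Section CauchyBinet.
Variables (R : comNzRingType) (E : finType) (n : nat).

(** Distributing each Leibniz product over the sums chooses one edge [f i] per row; the signed sum
    over permutations then reassembles a determinant in [B]. *)
Lemma det_mulmx_ffun (A : 'I_n -> E -> R) (B : 'I_n -> E -> R) :
  \det (\matrix_(i, j) \sum_e A i e * B j e) =
  \sum_(f : {ffun 'I_n -> E})
    (\prod_i A i (f i)) * \det (\matrix_(i, j) B i (f j)).
Proof.
under [RHS]eq_bigr do rewrite -det_tr.
rewrite /determinant; under [LHS]eq_bigr => s _.
  under eq_bigr do rewrite mxE.
  rewrite bigA_distr_bigA mulr_sumr; over.
rewrite exchange_big; apply: eq_bigr => f _; rewrite mulr_sumr.
apply: eq_bigr => s _; rewrite big_split mulrCA; congr (_ * (_ * _)).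
by apply: eq_bigr => i _; rewrite !mxE.
Qed.

(* Cauchy-Binet, summed over all functions instead of subsets: each column
   subset is counted [n`!] times. *)
Lemma det_weighted_gram (w : E -> R) (C : 'I_n -> E -> R) :
  \det (\matrix_(i, j) \sum_e C i e * w e * C j e) *+ n`! =
  \sum_(f : {ffun 'I_n -> E})
    (\prod_i w (f i)) * (\det (\matrix_(i, j) C i (f j))) ^+ 2.
Proof.
pose M (f : {ffun 'I_n -> E}) := \matrix_(i, j) C i (f j).
rewrite (det_mulmx_ffun (fun i e => C i e * w e)).
(* Each of the n! copies of the sum is reindexed by precomposing [f] with a permutation [s]:
   [\det (M f)] changes by the sign of [s], and summing over [s] produces the second determinant. *)
transitivity (\sum_(s : 'S_n) \sum_(f : {ffun 'I_n -> E})
   (\prod_i w (f i)) * ((-1) ^+ s * (\prod_i C (s i) (f i)) * \det (M f))).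
  rewrite -card_Sn -cardsT -sumr_const; apply: eq_big => [s|s _].
    by rewrite inE.
  pose h (g : {ffun 'I_n -> E}) := [ffun i => g (s i)].
  have h_bij : bijective h.
    exists (fun g : {ffun 'I_n -> E} => [ffun i => g ((s^-1)%g i)]) => g;
      by apply/ffunP => i; rewrite !ffunE ?permKV ?permK.
  rewrite [RHS](reindex h) /=; last exact: onW_bij.
  apply: eq_bigr => g _; rewrite big_split /=.
  have -> : \det (M (h g)) = (-1) ^+ s * \det (M g).
    rewrite mulrC -det_perm -[perm_mx s]trmxK tr_perm_mx.
    rewrite det_tr -det_mulmx -col_permE.
    by congr (\det _); apply/matrixP => i j; rewrite !mxE ffunE.
  have -> : \prod_i w (h g i) = \prod_i w (g i).
    by rewrite [RHS](reindex_perm s); apply: eq_bigr => i _; rewrite ffunE.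
  have -> : \prod_i C (s i) (h g i) = \prod_i C i (g i).
    by rewrite [RHS](reindex_perm s); apply: eq_bigr => i _; rewrite ffunE.
  by rewrite mulrACA -expr2 sqrr_sign mul1r mulrA [in RHS](mulrC (\prod_i w _)).
rewrite exchange_big; apply: eq_bigr => f _; rewrite -mulr_sumr -mulr_suml.
congr (_ * _); rewrite expr2 -{2}det_tr; congr (_ * _).
by apply: eq_bigr => s _; congr (_ * _); apply: eq_bigr => i _; rewrite !mxE.
Qed.
End CauchyBinet.

(** Injections from ['I_n] into a set of size [n] are onto, so it suffices to count injections. *)
Lemma card_inj_image (E : finType) (S : {set E}) n : #|S| = n ->
  #|[set f : {ffun 'I_n -> E} | injectiveb f && (f @: setT == S)]| = n`!.
Proof.
move=> cS; have -> : n`! = (#|S| ^_ #|'I_n|)%N by rewrite cS card_ord ffactnn.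
rewrite -card_inj_ffuns_on.
apply: eq_card => f; rewrite !inE andbC.
apply/andP/andP => -[H f_inj]; split=> //; last first.
  have fS : f @: setT \subset S.
    by apply/subsetP => _ /imsetP[i _ ->]; apply: (forallP H).
  rewrite eqEcard fS card_imset ?cardsT ?card_ord ?cS //=.
  exact: (injectiveP f f_inj).
by apply/forallP => i; rewrite -(eqP H) imset_f.
Qed.

(** * Walks and simple paths *)

Section Walks.
Variables (V E : finType) (src tgt : E -> V).
Implicit Types (F T : {set E}) (x y : V) (s : seq (E * bool)) (z : E -> int).

Local Notation walk := (walk src tgt).
Local Notation walk_verts := (walk_verts src tgt).

Lemma cat_walk x v y s1 s2 : walk x v s1 -> walk v y s2 -> walk x y (s1 ++ s2).
Proof.
by elim: s1 x => [|st s1 IH] x /= => [/eqP->|/andP[-> /IH w] /w].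
Qed.

Lemma walk_vertsP x y s v :
  walk x y s -> v \in walk_verts x s ->
  exists s1 s2, [/\ s = s1 ++ s2, walk v y s2 & uniq (walk_verts x s) ->
                    uniq (walk_verts v s2)].
Proof.
elim: s x => [|st s IH] x /=.
  by rewrite inE => /eqP-> /eqP->; exists [::], [::]; rewrite /= eqxx.
case/andP=> stx w; rewrite inE => /predU1P[->|vs].
  by exists [::], (st :: s); rewrite /= stx.
have [s1 [s2 [-> w2 u]]] := IH _ w vs.
by exists (st :: s1), s2; split=> //= /andP[_ /u].
Qed.

Lemma walk_verts_ends x y s st : walk x y s -> st \in s ->
  (src st.1 \in walk_verts x s) && (tgt st.1 \in walk_verts x s).
Proof.
elim: s x => [|st' s IH] x //= /andP[/eqP stx w].
rewrite inE => /predU1P[->|/(IH _ w)/andP[ss ts]].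
  rewrite -stx /Defs.walk_verts /= /step_src /step_tgt.
  by case: st'.2; rewrite !inE !eqxx ?orbT.
rewrite /Defs.walk_verts /= !(in_cons x) in ss ts *.
by rewrite ss ts !orbT.
Qed.

(** By induction: prepend the first step to a simple path or, if that path already visits [x], keep
    only its suffix from [x]. *)
Lemma walk_simple F x y s : walk x y s -> in_edges F s ->
  exists s', simple_path src tgt F x y s'.
Proof.
elim: s x => [|st s IH] x /=.
  by move=> xy _; exists [::]; rewrite /simple_path /= xy.
case/andP=> /eqP stx w /andP[stF sF].
have [s' /and4P[w' F' ue uv]] := IH _ w sF.
case xs: (x \in walk_verts (step_tgt src tgt st) s').
  have [s1 [s2 [es w2 u2]]] := walk_vertsP w' xs.
  exists s2; apply/and4P; split=> //; last exact: u2.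
    by move: F'; rewrite /in_edges es all_cat => /andP[].
  by move: ue; rewrite es map_cat cat_uniq => /and3P[].
exists (st :: s'); apply/and4P; split=> //=.
- by rewrite stx eqxx.
- by rewrite stF.
(* A repeated edge would put its endpoint [x] on [s'], against [xs]. *)
- rewrite ue andbT; apply/negP=> /mapP[st' st's est].
  have /andP[] := walk_verts_ends w' st's; rewrite -est.
  by move: xs; rewrite -stx /step_src; case: ifP => _ ->.
- by rewrite xs.
Qed.

(** * Chains, boundaries and cycles *)

Definition chain s (e : E) : int :=
  \sum_(st <- s | st.1 == e) (if st.2 then 1 else -1).

Lemma chain_notin F s e : in_edges F s -> e \notin F -> chain s e = 0.
Proof.
move=> /allP sF eF; rewrite /chain big_seq_cond big1 // => st /andP[/sF stF].
by move=> /eqP est; rewrite est (negPf eF) in stF.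
Qed.

(** Without repeated edges nothing cancels: the coefficient is 1 or -1. *)
Lemma chain_uniq s st : uniq (map fst s) -> st \in s -> chain s st.1 != 0.
Proof.
rewrite /chain; elim: s => [|st' s IH] //= /andP[st's u].
rewrite big_cons inE => /predU1P[->|sts].
  rewrite eqxx big_seq_cond big1 ?addr0; first by case: st'.2.
  by move=> i /andP[is_ /eqP ei]; rewrite -ei map_f in st's.
case: (st'.1 =P st.1) => [est|_]; last exact: IH.
by rewrite est map_f in st's.
Qed.

(* The value of [h], extended linearly, on the boundary of [z]; it vanishes for
   all [h] exactly when the boundary of [z] is zero. *)
Definition pairing z (h : V -> int) : int :=
  \sum_e z e * (h (tgt e) - h (src e)).
Definition is_cycle z := forall h, pairing z h = 0.

Lemma eq_pairing z1 z2 h : z1 =1 z2 -> pairing z1 h = pairing z2 h.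
Proof. by move=> e12; apply: eq_bigr => e _; rewrite e12. Qed.

Lemma pairingD z1 z2 h :
  pairing (fun e => z1 e + z2 e) h = pairing z1 h + pairing z2 h.
Proof.
by rewrite /pairing -big_split; apply: eq_bigr => e _; rewrite mulrDl.
Qed.

Lemma pairing_sum (I : finType) (c : I -> int) (Z : I -> E -> int) h :
  pairing (fun e => \sum_i c i * Z i e) h = \sum_i c i * pairing (Z i) h.
Proof.
rewrite /pairing; under eq_bigr do rewrite mulr_suml.
rewrite exchange_big; apply: eq_bigr => i _; rewrite mulr_sumr.
by apply: eq_bigr => e _; rewrite mulrA.
Qed.

Lemma pairing_delta e0 (c : int) h :
  pairing (fun e => c *+ (e == e0)) h = c * (h (tgt e0) - h (src e0)).
Proof.
rewrite /pairing (bigD1 e0) //= eqxx big1 ?addr0 // => e /negPf->.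
by rewrite mul0r.
Qed.

(** The sum telescopes along the walk; in particular closed walks give cycles. *)
Lemma pairing_chain x y s h : walk x y s -> pairing (chain s) h = h y - h x.
Proof.
elim: s x => [|st s IH] x /=.
  move/eqP->; rewrite subrr /pairing big1 // => e _.
  by rewrite /chain big_nil mul0r.
case/andP=> /eqP stx /IH {}IH; pose c : int := if st.2 then 1 else -1.
rewrite (eq_pairing (z2 := fun e => c *+ (e == st.1) + chain s e)).
  rewrite pairingD pairing_delta IH -stx /c /step_tgt /step_src.
  by case: st.2; rewrite ?mul1r ?mulN1r ?opprB addrC addrA subrK.
move=> e; rewrite /chain big_cons eq_sym.
by case: ifP => _ //; rewrite mulr0n add0r.
Qed.

Lemma is_cycle_comb (I : finType) (c : I -> int) (Z : I -> E -> int) :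
  (forall i, is_cycle (Z i)) -> is_cycle (fun e => \sum_i c i * Z i e).
Proof.
move=> cyc h; rewrite pairing_sum big1 // => i _.
by rewrite cyc mulr0.
Qed.

Lemma is_cycleB z1 z2 :
  is_cycle z1 -> is_cycle z2 -> is_cycle (fun e => z1 e - z2 e).
Proof.
move=> c1 c2 h; rewrite pairingD c1 add0r.
have : pairing (fun e => - z2 e) h = - pairing z2 h.
  by rewrite /pairing -sumrN; apply: eq_bigr => e _; rewrite mulNr.
by move->; rewrite c2 oppr0.
Qed.

(** * Components of an edge set *)

Definition reach F x y : bool :=
  Defs.decP (exists s, walk x y s && in_edges F s).

Lemma reach_refl F x : reach F x x.
Proof. by apply/decPP; exists [::]; rewrite /= eqxx. Qed.

Lemma reach_edge F x e : e \in F -> reach F x (src e) = reach F x (tgt e).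
Proof.
move=> eF; apply/decPP/decPP => -[s /andP[w sF]].
  exists (s ++ [:: (e, true)]); rewrite /in_edges all_cat -/(in_edges F s) sF /= eF !andbT.
  by apply: cat_walk w _; rewrite /= !eqxx.
exists (s ++ [:: (e, false)]); rewrite /in_edges all_cat -/(in_edges F s) sF /= eF !andbT.
by apply: cat_walk w _; rewrite /= !eqxx.
Qed.

(* Pair [z] with the indicator of the component of [x] in [F]: only the edges
   outside [F] can contribute. *)
Lemma pairing_reach F x z e0 : is_cycle z ->
  (forall e, e \notin F -> e != e0 -> z e = 0) -> z e0 != 0 ->
  reach F x (src e0) = reach F x (tgt e0).
Proof.
move=> cyc z0 ze0; have := cyc (fun y => (reach F x y)%:R).
rewrite /pairing (bigD1 e0) //= big1 ?addr0.
  move/eqP; rewrite mulf_eq0 (negPf ze0) subr_eq0 /=.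
  by case: (reach F x (src e0)); case: (reach F x (tgt e0)).
move=> e ne; case eF: (e \in F); first by rewrite (reach_edge _ eF) subrr mulr0.
by rewrite z0 ?mul0r // eF.
Qed.

(** If [z f] is nonzero, [pairing_reach] joins the ends of [f] inside [T :\ f]; a simple such path,
    closed up by [f], contradicts acyclicity. *)
Lemma acyclic_cycle0 T z : acyclic src tgt T -> is_cycle z ->
  (forall e, e \notin T -> z e = 0) -> forall e, z e = 0.
Proof.
move=> acT cyc zT f; apply/eqP; apply/negPn/negP => zf.
have fT : f \in T by apply: contraNT zf => /zT->.
have : reach (T :\ f) (tgt f) (src f).
  rewrite (@pairing_reach _ _ z) ?reach_refl // => e.
  by rewrite !inE negb_and negbK => /orP[->|/zT].
case/decPP=> s /andP[w sF]; have [s' /and4P[w' F' ue _]] := walk_simple w sF.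
suff: (f, true) :: s' = [::] by [].
apply: (acT (src f)); rewrite /= ?eqxx ?fT //=.
  by apply: sub_all F' => st; rewrite !inE => /andP[].
rewrite ue andbT; apply/negP => /mapP[st st_s ef].
by move/allP: F' => /(_ _ st_s); rewrite -ef !inE eqxx.
Qed.

Lemma connected_reach T : (forall x y, reach T x y) -> connected_in src tgt T.
Proof. by move=> rT x y; apply/decPP/rT. Qed.

Lemma reach_walk F x y s : (forall e, reach F x (src e) = reach F x (tgt e)) ->
  walk x y s -> reach F x y.
Proof.
move=> rF; suff H v : reach F x v -> walk v y s -> reach F x y.
  exact/H/reach_refl.
elim: s v => [|st s IH] v rv /=; first by move/eqP<-.
case/andP=> /eqP stv; apply: IH; move: rv.
by rewrite -stv /step_src /step_tgt; case: st.2; rewrite rF.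
Qed.

(** * Fundamental cycles of a spanning tree *)

Definition fundamental T (Z : E -> E -> int) :=
  (forall e, e \notin T -> is_cycle (Z e)) /\
  forall e e', e \notin T -> e' \notin T -> Z e e' = (e' == e)%:R.

(** A walk in [T] from the target of [e] back to its source closes [e] up, and its chain vanishes
    off [T]. *)
Lemma spanning_tree_fundamental T : spanning_tree src tgt T ->
  exists Z, fundamental T Z.
Proof.
move=> [conT _]; pose p e := xchoose (conT (tgt e) (src e)).
exists (fun e e' => 1 *+ (e' == e) + chain (p e) e').
split=> [e _ h|e e' _ e'T].
  have /andP[w _] := xchooseP (conT (tgt e) (src e)).
  by rewrite pairingD pairing_delta (pairing_chain _ w) mul1r addrC subrKA subrr.
have /andP[_ pT] := xchooseP (conT (tgt e) (src e)).
by rewrite (chain_notin pT) ?addr0.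
Qed.

(** Both sides are cycles that agree off [T], so [acyclic_cycle0] kills their difference. *)
Lemma fundamental_expand T Z z : acyclic src tgt T -> fundamental T Z ->
  is_cycle z ->
  forall e, z e = \sum_(i < #|~: T|) z (enum_val i) * Z (enum_val i) e.
Proof.
move=> acT [cycZ ZT] cz e; apply/eqP; rewrite -subr_eq0; apply/eqP.
move: e; apply: acyclic_cycle0 acT _ _.
  apply: is_cycleB cz _; apply: is_cycle_comb => i; apply: cycZ.
  by have := enum_valP i; rewrite inE.
move=> e eT; have eT' : e \in ~: T by rewrite inE.
rewrite (bigD1 (enum_rank_in eT' e)) //= enum_rankK_in // ZT // eqxx mulr1.
rewrite big1 ?addr0 ?subrr // => i ne.
have iT : enum_val i \notin T by have := enum_valP i; rewrite inE.
rewrite ZT //; case: eqP => [ei|]; last by rewrite mulr0.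
by have := congr1 (enum_rank_in eT') ei; rewrite enum_valK_in => ri;
   rewrite ri eqxx in ne.
Qed.

(** Expanding each fundamental family in the other gives integer matrices with [A *m B = 1%:M], so
    [A] has at most as many rows as columns. *)
Lemma spanning_tree_leq_card T1 T2 : spanning_tree src tgt T1 ->
  spanning_tree src tgt T2 -> (#|~: T1| <= #|~: T2|)%N.
Proof.
move=> st1 st2; have [Z1 [cyc1 Z1T]] := spanning_tree_fundamental st1.
have [Z2 F2] := spanning_tree_fundamental st2.
pose A := \matrix_(i < #|~: T1|, j < #|~: T2|) Z1 (enum_val i) (enum_val j).
pose B := \matrix_(j < #|~: T2|, i < #|~: T1|) Z2 (enum_val j) (enum_val i).
apply: (@mulmx1_min _ _ _ A B); apply/matrixP => i k; rewrite !mxE.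
have nT (l : 'I_#|~: T1|) : enum_val l \notin T1.
  by have := enum_valP l; rewrite inE.
under eq_bigr do rewrite !mxE.
rewrite -(fundamental_expand (proj2 st2) F2) ?Z1T //; last exact: cyc1.
by rewrite (inj_eq enum_val_inj) eq_sym.
Qed.

Lemma spanning_tree_card T1 T2 : spanning_tree src tgt T1 ->
  spanning_tree src tgt T2 -> #|~: T1| = #|~: T2|.
Proof. by move=> st1 st2; apply/eqP; rewrite eqn_leq !spanning_tree_leq_card. Qed.

(** * Minors of the fundamental cycle matrix *)

Section Minors.
Variables (T0 : {set E}) (Z : E -> E -> int).
Hypotheses (conE : connected_in src tgt [set: E]).
Hypotheses (acT0 : acyclic src tgt T0) (fundZ : fundamental T0 Z).
Variable f : {ffun 'I_#|~: T0| -> E}.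

Local Notation T := (~: (f @: setT)).
Local Notation minor := (\matrix_(i < #|~: T0|, j < #|~: T0|) Z (enum_val i) (f j)).

Let fT i : f i \notin T.
Proof. by rewrite inE negbK imset_f. Qed.

Let expand z := @fundamental_expand T0 Z z acT0 fundZ.

(** Row [i] of [A] holds the coordinates, along [Z], of the [T]-cycle through [f i]. Evaluating that
    cycle at [f k] gives the identity matrix, so the minor is a unit of the integers. *)
Lemma minor_spanning_tree : injective f -> spanning_tree src tgt T ->
  (\det minor) ^+ 2 = 1.
Proof.
move=> f_inj stT; have [Z1 [cyc1 Z1T]] := spanning_tree_fundamental stT.
pose A := \matrix_(i < #|~: T0|, j < #|~: T0|) Z1 (f i) (enum_val j).
have : A *m minor = 1%:M.
  apply/matrixP => i k; rewrite !mxE; under eq_bigr do rewrite !mxE.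
  rewrite -expand ?Z1T //; last exact: cyc1.
  by rewrite (inj_eq f_inj) eq_sym.
move/(congr1 determinant); rewrite det_mulmx det1.
by move/intUnitRing.unitzPl=> ?; apply/eqP; rewrite sqrf_eq1.
Qed.

(** A closed walk in [T] gives a cycle vanishing on the image of [f], so the minor kills its
    coordinate row; the adjugate then forces that row, hence the cycle, to be zero. *)
Lemma minor_acyclic : \det minor != 0 -> acyclic src tgt T.
Proof.
move=> d0 x s w sT us; case: s => // st s in w sT us *.
pose z := chain (st :: s).
have cz : is_cycle z by move=> h; rewrite (pairing_chain h w) subrr.
pose a : 'rV_#|~: T0| := \row_k z (enum_val k).
have aM : a *m minor = 0.
  apply/rowP => i; rewrite !mxE; under eq_bigr do rewrite !mxE.
  by rewrite -expand //; apply: chain_notin sT _.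
have a0 : a = 0.
  apply/eqP; have /eqP := congr1 (mulmx^~ (\adj minor)) aM.
  by rewrite -mulmxA mul_mx_adj mul0mx mul_mx_scalar scalemx_eq0 (negPf d0).
have /eqP[] := chain_uniq us (mem_head st s).
rewrite -/z expand // big1 // => i _.
by have /rowP/(_ i) := a0; rewrite !mxE => ->; rewrite mul0r.
Qed.

Lemma minor_connected : \det minor != 0 -> connected_in src tgt T.
Proof.
move=> d0; apply: connected_reach => x y; have [s /andP[w _]] := conE x y.
apply: reach_walk w => e; case eT: (e \in T); first exact: reach_edge.
have /imsetP[i _ ei] : e \in f @: setT 
  by rewrite inE in eT; apply/negPn; rewrite eT.
(* Row [i] of the adjugate builds a cycle whose only nonzero value outside [T] is at [e = f i], so
   [pairing_reach] joins the ends of [e] within [T]. *)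
pose z e := \sum_k \adj minor i k * Z (enum_val k) e.
have zf j : z (f j) = \det minor *+ (i == j).
  have /matrixP/(_ i j) := mul_adj_mx minor; rewrite !mxE => <-.
  by apply: eq_bigr => k _; rewrite !mxE.
apply: (@pairing_reach _ _ z).
- apply: is_cycle_comb => k; apply: (proj1 fundZ).
  by have := enum_valP k; rewrite inE.
- move=> e'; rewrite inE negbK => /imsetP[j _ ->]; rewrite ei zf.
  by case: (i =P j) => // ->; rewrite eqxx.
- by rewrite ei zf eqxx.
Qed.

Lemma sqr_minor :
  (\det minor) ^+ 2 = (injectiveb f && spanning_treeb src tgt T)%:R.
Proof.
case: (injectiveP f) => [f_inj|/injectiveP/injectivePn[i [j ne fij]]]; last first.
  rewrite -det_tr (determinant_alternate ne) ?expr0n // => k.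
  by rewrite !mxE fij.
rewrite /= /spanning_treeb; case: (decPP (spanning_tree src tgt T)) => [|nst].
  exact: minor_spanning_tree.
have [->|d0] := eqVneq (\det minor) 0; first by rewrite expr0n.
by case: nst; split; [apply: minor_connected | apply: minor_acyclic].
Qed.
End Minors.
End Walks.

(** * The mesh matrix and its weighted determinant *)

Section Mesh.
Variables (V E : finType) (src tgt : E -> V) (T0 : {set E}).
Variable path : E -> seq (E * bool).
Hypothesis conE : connected_in src tgt [set: E].
Hypothesis treeT0 : spanning_tree src tgt T0.
Hypothesis pathP : forall e, e \notin T0 -> src e != tgt e ->
  simple_path src tgt T0 (tgt e) (src e) (path e).

Local Notation N := #|~: T0|.
Local Notation treeb := (spanning_treeb src tgt).
Implicit Type T : {set E}.

(** The cycle $Z[e]$ as a row over all edges: entries of $Y$ on [T0], of the identity off [T0]. *)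
Definition mesh_cycle (e e' : E) : int :=
  if e' \in T0 then Dcoef src tgt path e' e else (e' == e)%:R.

Lemma mesh_cycle_fundamental : fundamental src tgt T0 mesh_cycle.
Proof.
split=> [e eT h|e e' _ e'T]; last by rewrite /mesh_cycle (negPf e'T).
rewrite (@eq_pairing _ _ src tgt _
  (fun e' => 1 *+ (e' == e) + Dcoef src tgt path e' e)).
  rewrite pairingD pairing_delta mul1r /Dcoef; case: eqP => [->|/eqP ne].
    by rewrite subrr add0r /pairing big1 // => e' _; rewrite mul0r.
  have /and4P[w _ _ _] := pathP eT ne.
  by rewrite (pairing_chain h w) addrC subrKA subrr.
move=> e'; rewrite /mesh_cycle; case: ifPn => e'T.
  by case: eqP => [ee|_]; [rewrite ee (negPf eT) in e'T | rewrite add0r].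
rewrite /Dcoef; case: (src e =P tgt e) => [_|/eqP ne]; first by rewrite addr0.
have /and4P[_ pT _ _] := pathP eT ne.
by rewrite -/(chain (path e) e') (chain_notin pT) ?addr0.
Qed.

Section Weighted.
Variables (R : comNzRingType) (phi : {rmorphism int -> R}) (a b : R).

Local Notation w := (fun e : E => if e \in T0 then b else a).

(** Edges of [T0] contribute $b\,Y^tY$; off [T0] the rows are unit vectors and give [a] on the
    diagonal. *)
Lemma weighted_mesh :
  a%:M + b *: map_mx phi (MeshS src tgt T0 path) =
  \matrix_(i < N, j < N) \sum_e phi (mesh_cycle (enum_val i) e) * w e *
                                phi (mesh_cycle (enum_val j) e).
Proof.
apply/matrixP => i j; rewrite !mxE rmorph_sum mulr_sumr.
rewrite (bigID [in T0]) /= addrC; congr (_ + _).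
  rewrite (big_enum_val (A := [in T0])); apply: eq_bigr => k _.
  rewrite !mxE rmorphM /mesh_cycle (enum_valP k) mulrA.
  by rewrite (mulrC b).
have nT (l : 'I_N) : enum_val l \notin T0 by have := enum_valP l; rewrite inE.
rewrite (bigD1 (enum_val i)) //= big1 ?addr0 => [|e /andP[eT ne]].
  rewrite /mesh_cycle !(negPf (nT _)) eqxx rmorph1 mul1r.
  by rewrite (inj_eq enum_val_inj) rmorph_nat mulr_natr.
by rewrite /mesh_cycle (negPf eT) (negPf ne) rmorph0 !mul0r.
Qed.

(** Complements of spanning trees have equal size, so [T] omits as many edges of [T0] as it has
    edges off [T0]. *)
Lemma prod_weight T : spanning_tree src tgt T ->
  \prod_(e in ~: T) w e =
  b ^+ #|T :&: ~: T0| * a ^+ (N - #|T :&: ~: T0|).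
Proof.
move=> stT; have cT := spanning_tree_card stT treeT0.
have e1 := cardsID T0 (~: T); have e2 := cardsID T (~: T0).
have eD : ~: T0 :\: T = ~: T :\: T0 by rewrite !setDE setIC.
rewrite eD setIC in e2; rewrite (bigID [in T0]) /=; congr (_ * _).
  under eq_bigr => e /andP[_ ->] do [].
  rewrite prodr_const; congr (_ ^+ _); apply/eqP.
  rewrite -(eqn_add2r #|~: T :\: T0|) e2 -cT -e1 eqn_add2r; apply/eqP.
  by apply: eq_card => e; rewrite [LHS]unfold_in !inE.
under eq_bigr => e /andP[_ /negPf->] do [].
rewrite prodr_const -e2 addKn; congr (_ ^+ _).
by apply: eq_card => e; rewrite [LHS]unfold_in !inE andbC.
Qed.

(** The injectivity hypothesis cancels the factor N! of [det_weighted_gram]; by [sqr_minor] only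
    injections onto complements of spanning trees survive. *)
Lemma det_weighted_mesh : injective (fun x : R => x *+ N`!) ->
  \det (a%:M + b *: map_mx phi (MeshS src tgt T0 path)) =
  \sum_(T | treeb T) b ^+ #|T :&: ~: T0| * a ^+ (N - #|T :&: ~: T0|).
Proof.
apply; rewrite /= weighted_mesh.
rewrite (det_weighted_gram w (fun i e => phi (mesh_cycle (enum_val i) e))).
pose im (f : {ffun 'I_N -> E}) := ~: (f @: setT).
transitivity (\sum_(f : {ffun 'I_N -> E} | injectiveb f && treeb (im f))
                \prod_(e in ~: im f) w e).
  rewrite [RHS]big_mkcond; apply: eq_bigr => f _.
  pose M := \matrix_(i < N, j < N) mesh_cycle (enum_val i) (f j).
  have -> : \matrix_(i < N, j < N) phi (mesh_cycle (enum_val i) (f j))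
            = map_mx phi M by apply/matrixP => i j; rewrite !mxE.
  rewrite det_map_mx -rmorphXn (sqr_minor conE (proj2 treeT0)) /=;
    last exact: mesh_cycle_fundamental.
  rewrite -/(im f) rmorph_nat mulr_natr; case: ifP => // /andP[/injectiveP f_inj _].
  rewrite setCK big_imset /=; last by move=> ? ? _ _; apply: f_inj.
  by apply: eq_bigl => i; rewrite inE.
(* Functions are grouped by their tree; each group has N! members of equal weight. *)
rewrite (partition_big im treeb) => [|f /andP[]//]; rewrite -sumrMnl.
apply: eq_bigr => T /decPP stT.
rewrite -prod_weight // -(card_inj_image (spanning_tree_card stT treeT0)).
rewrite -sumr_const; apply: eq_big => [f|f /andP[_ /eqP->] //].
have -> : (f \in [set g : {ffun 'I_N -> E} |
                    injectiveb g && (g @: setT == ~: T)]) =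
          injectiveb f && (im f == T).
  by rewrite inE -(inj_eq (@setC_inj _)) setCK.
by case: eqP => [->|_]; rewrite ?andbF // /spanning_treeb (introT (decPP _) stT) !andbT.
Qed.
End Weighted.

Lemma sum_ST (R : nmodType) (F : nat -> R) :
  \sum_(T | treeb T) F #|T :&: ~: T0| =
  \sum_(0 <= j < N.+1) F j *+ ST src tgt T0 j.
Proof.
have leN T : (#|T :&: ~: T0| < N.+1)%N by rewrite ltnS subset_leq_card ?subsetIr.
rewrite big_mkord.
rewrite (partition_big (fun T => Ordinal (leN T)) predT) //.
apply: eq_bigr => j _; rewrite -sumr_const; apply: eq_big => T.
  by rewrite !inE.
by move=> /andP[_ /eqP<-].
Qed.

(** A spanning tree without edges off [T0] lies in [T0] and has the same size. This gives the
    leading term ['X^N]. *)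
Lemma ST0 : ST src tgt T0 0 = 1%N.
Proof.
rewrite /ST -(cards1 T0); apply: eq_card => T; rewrite !inE.
apply/andP/eqP => [[/decPP stT]|->]; last first.
  by split; [apply/decPP | rewrite setICr cards0].
rewrite cards_eq0 -setDE setD_eq0 => sT; apply/eqP; rewrite eqEcard sT /=.
by rewrite cardsCs (cardsCs T) (spanning_tree_card stT treeT0).
Qed.
End Mesh.

(** * The characteristic polynomial and the tree count *)

Theorem theorem2p2 (V E : finType) (src tgt : E -> V) (T0 : {set E})
    (path : E -> seq (E * bool)) :
  connected_in src tgt [set: E] ->
  spanning_tree src tgt T0 ->
  (forall e, e \notin T0 -> src e != tgt e ->
     simple_path src tgt T0 (tgt e) (src e) (path e)) ->
  let N := #|~: T0| in
  \det (('X + 1)%:M - map_mx polyC (Mesh src tgt T0 path))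
    = \det ('X%:M - map_mx polyC (MeshS src tgt T0 path)) /\
  \det ('X%:M - map_mx polyC (MeshS src tgt T0 path))
    = 'X^N + \sum_(1 <= j < N.+1)
               (((-1) ^+ j * (ST src tgt T0 j)%:R) : int) *: 'X^(N - j) /\
  \det (Mesh src tgt T0 path) = (\sum_(0 <= j < N.+1) ST src tgt T0 j)%:R /\
  \det (Mesh src tgt T0 path) = (num_spanning_trees src tgt)%:R.
Proof.
move=> conE treeT0 pathP N.
have detM : \det (Mesh src tgt T0 path) =
    \sum_(T | spanning_treeb src tgt T) 1.
  (* With both weights 1, every spanning tree counts once. *)
  have := @det_weighted_mesh _ _ _ _ _ _ conE treeT0 pathP int idfun 1 1.
  rewrite scale1r map_mx_id // -/(Mesh src tgt T0 path) => ->.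
    by apply: eq_bigr => T _; rewrite !expr1n mulr1.
  exact/pmulrnI/fact_gt0.
split; last split; last split.
- congr (\det _); rewrite /Mesh map_mxD map_mx1 raddfD /= opprD.
  by rewrite addrA addrK.
(* Here the weights are ['X] off [T0] and -1 on [T0]; N! is cancelled coefficientwise. *)
- rewrite -scaleN1r (det_weighted_mesh conE treeT0 pathP); last first.
    move=> p q pq; apply/polyP => i; apply: (pmulrnI (fact_gt0 N)).
    by rewrite -!coefMn pq.
  rewrite (sum_ST src tgt T0 (fun j => (-1) ^+ j * 'X^(N - j))).
  rewrite big_nat_recl // ST0 // expr0 mul1r subn0 mulr1n; congr (_ + _).
  rewrite big_add1 /=; apply: eq_bigr => j _.
  rewrite -mul_polyC rmorphM rmorphXn rmorphN1 rmorph_nat.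
  by rewrite mulr_natr mulrnAl.
- by rewrite detM (sum_ST src tgt T0 (fun=> 1)) natr_sum.
- by rewrite detM sumr_const /num_spanning_trees cardsE.
Qed.
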